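(* Let $G=(V,E)$ be an undirected graph with a finite vertex set, containing no multi-edges and no self-loops, let $(J_{x,y})_{x,y\in V}$ be real numbers with $J_{x,y}=J_{y,x}$ for all $x,y\in V$ and $J_{x,y}=0$ whenever $\{x,y\}\notin E$, and let $(h_x)_{x\in V}$ be real numbers. Let $\Omega=\{-1,+1\}^V$, let $H:\Omega\to\mathbb{R}$ be $$H(\sigma)=-\frac12\sum_{x,y\in V}J_{x,y}\sigma_x\sigma_y-\sum_{x\in V}h_x\sigma_x ,$$ and let $\mathrm{GS}=\{\sigma\in\Omega: H(\sigma)=\min_{\tau\in\Omega}H(\tau)\}$. For $\beta\in(0,\infty)$ let $P_\beta^{\mathrm{DA}}$ be the Digital Annealer transition matrix on $\Omega$ associated with $H$ (defined in the context). Let $(\beta_k)_{k\ge1}$ be a cooling schedule, that is, a nondecreasing sequence of positive real numbers such that $\lim_{k\to\infty}\beta_k=+\infty$, and let $(X_k)_{k\ge0}$ be the discrete-time inhomogeneous Markov chain satisfying $$\mathbb{P}(X_k=\sigma_k\mid X_{k-1}=\sigma_{k-1},\dots,X_0=\sigma_0)=\mathbb{P}(X_k=\sigma_k\mid X_{k-1}=\sigma_{k-1})=P_{\beta_k}^{\mathrm{DA}}(\sigma_{k-1},\sigma_k)$$ for every positive integer $k$ and $\sigma_0,\dots,\sigma_k$ in $\Omega$. Then, there exists a constant $\gamma^\ast$ such that the limit $$\lim_{k\to\infty}\mathbb{P}(X_k\in\mathrm{GS})=1$$ holds if and only if $$\sum_{k=1}^\infty e^{-\beta_k\gamma^\ast}=+\infty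 .$$
   Context: For $\sigma\in\Omega=\{-1,+1\}^V$ and $x\in V$, $\sigma^x\in\Omega$ denotes the configuration with $(\sigma^x)_x=-\sigma_x$ and $(\sigma^x)_y=\sigma_y$ for $y\ne x$. Put $E_x(\sigma)=H(\sigma^x)-H(\sigma)$ and $E_x(\sigma)^+=\max\{E_x(\sigma),0\}$. For $\beta\in(0,\infty)$ the Digital Annealer transition matrix $P_\beta^{\mathrm{DA}}$ on $\Omega$ is defined by: - if $\tau=\sigma^x$ for some $x\in V$, $$P_\beta^{\mathrm{DA}}(\sigma,\tau)=\sum_{S\subseteq V,\ S\ni x}\frac1{|S|}\prod_{y\in S}e^{-\beta E_y(\sigma)^+}\prod_{y\in V\setminus S}\bigl(1-e^{-\beta E_y(\sigma)^+}\bigr);$$ - if $\tau=\sigma$, $P_\beta^{\mathrm{DA}}(\sigma,\sigma)=\prod_{y\in V}\bigl(1-e^{-\beta E_y(\sigma)^+}\bigr)$; - $P_\beta^{\mathrm{DA}}(\sigma,\tau)=0$ otherwise. *)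

(* Defs.v *)
From HB Require Import structures.
From mathcomp Require Import all_boot all_order all_algebra.
From mathcomp Require Import all_classical all_reals all_analysis.
Import Order.TTheory GRing.Theory Num.Theory.
Import numFieldNormedType.Exports.

Set Implicit Arguments.
Unset Strict Implicit.
Unset Printing Implicit Defensive.

Local Open Scope classical_set_scope.
Local Open Scope ring_scope.

(* {-1,+1}^V, with true standing for +1 and false for -1; [spin] reads off the
   numerical value. *)
Notation config V := {ffun V -> bool}.

Definition spin (R : realType) (V : finType) (sigma : config V) (x : V) : R :=
  if sigma x then 1 else -1.

Definition flip (V : finType) (sigma : config V) (x : V) : config V :=
  [ffun y => if y == x then ~~ sigma y else sigma y].

Definition hamiltonian (R : realType) (V : finType)
    (J : V -> V -> R) (h : V -> R) (sigma : config V) : R :=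
  - (2^-1 * \sum_(x : V) \sum_(y : V) J x y * spin R sigma x * spin R sigma y)
  - \sum_(x : V) h x * spin R sigma x.

Section energy.
Variables (R : realType) (V : finType) (H : config V -> R).

(* [ffun=> true] only witnesses that the configuration space is nonempty. *)
Definition min_energy : R :=
  H [arg min_(tau < ([ffun=> true] : config V)) H tau]%O.

Definition ground_states : set (config V) :=
  [set sigma | H sigma = min_energy].

Definition energy_gap (x : V) (sigma : config V) : R :=
  H (flip sigma x) - H sigma.

Definition accept (beta : R) (sigma : config V) (x : V) : R :=
  expR (- (beta * Num.max (energy_gap x sigma) 0)).

(* The site picked in the first branch is unique, since distinct sites give
   distinct flips. *)
Definition DA_matrix (beta : R) (sigma tau : config V) : R :=
  if [pick x | tau == flip sigma x] is Some x then
    \sum_(S : {set V} | x \in S)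
      (#|S|%:R)^-1 * (\prod_(y in S) accept beta sigma y)
                   * (\prod_(y in ~: S) (1 - accept beta sigma y))
  else if tau == sigma then \prod_(y : V) (1 - accept beta sigma y)
  else 0.

End energy.

(* The schedule is indexed from 1; its value at 0 is irrelevant. *)
Definition cooling_schedule (R : realType) (beta : nat -> R) : Prop :=
  [/\ forall k, (1 <= k)%N -> 0 < beta k,
      forall k l, (1 <= k)%N -> (k <= l)%N -> beta k <= beta l
    & beta k @[k --> \oo] --> +oo].

Definition cond_prob d (T : measurableType d) (R : realType)
    (P : probability T R) (A B : set T) : R :=
  fine (P (A `&` B)) / fine (P B).

(* The law of X 0 is arbitrary.  Conditional probabilities are constrained only
   when the conditioning event has positive probability.  All subsets of the
   finite state space S are measurable. *)
Definition inhomogeneous_markov_chain d (T : measurableType d) (R : realType)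
    (P : probability T R) (S : finType) (K : nat -> S -> S -> R)
    (X : nat -> T -> S) : Prop :=
  (forall k (A : set S), measurable (X k @^-1` A)) /\
  forall (k : nat) (s : nat -> S), (1 <= k)%N ->
    let now := [set t | X k t = s k] in
    let previous := [set t | X k.-1 t = s k.-1] in
    let history := [set t | forall j, (j < k)%N -> X j t = s j] in
    (0 < P history)%E ->
    cond_prob P now history = cond_prob P now previous /\
    cond_prob P now previous = K k (s k.-1) (s k).

(* Main.v *)
Require Import Defs.
From HB Require Import structures.
From mathcomp Require Import all_boot all_order all_algebra.
From mathcomp Require Import all_classical all_reals all_analysis.
From mathcomp Require Import ring lra zify.
Import Order.TTheory GRing.Theory Num.Theory.
Import numFieldNormedType.Exports.

Set Implicit Arguments.
Unset Strict Implicit.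
Unset Printing Implicit Defensive.

Local Open Scope classical_set_scope.
Local Open Scope ring_scope.

(** The selection rule enters only through the bounds
    e^(-beta E_x^+) / |V| <= P(s, s^x) <= e^(-beta E_x^+),
    so that e^(-beta H s) P(s, t) is comparable to e^(-beta w(s,t)) with the
    symmetric weight w(s,t) = max (H s) (H t).  Grow the state space from a root
    set A as in Prim's algorithm: n s is the time at which s is added, x l the
    weight of the l-th added edge.  Every edge crossing rank l has weight at
    least x l, so for E = max (x 1, ..., x i) and q small the function
      g(s) = sum over 1 <= l <= min(i, n s) of q^l e^(-beta (E - x l))
    is a supersolution away from A: at rank j <= i its drift is at most
    - (c/2) q^j e^(-beta (E - H s)) with c = 1/|V|, the descent along the edge to the parent
    beating all the climbs.  It is moreover nonincreasing in beta, hence usable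
    for inhomogeneous chains.  The constant gamma is the largest value of
    (minimax height from s to GS) - H s over s outside GS.
    - Sufficiency: with A = GS, induct downwards on i to show that the mass of
      {n s >= i} tends to 0.
    - Necessity: with A = {b}, b a state realising gamma, the drift of g is at
      most (c/2) e^(-beta gamma), which is summable, so the chain restarted at b
      late enough is at each later time outside GS with probability at least 1/2. *)

(** * Growth orders *)

Section growth_order.
Variables (R : realType) (S : finType) (adj : rel S) (w : S -> S -> R).

(** The last clause is the cut property of Prim's algorithm: when the [l]-th state was added, the
    edge from [s] to [t] was available, so the chosen edge is no heavier. *)
Definition growth_order (A : {set S}) (n : S -> nat) (x : nat -> R) :=
  [/\ forall s, (n s == 0)%N = (s \in A),
      forall s, (0 < n s)%N ->
        exists t, [/\ (n t < n s)%N, adj t s & w t s = x (n s)]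
    & forall s t l, adj s t -> (n s < l <= n t)%N -> x l <= w s t].

Definition edge_connected :=
  forall A : {set S}, A != finset.set0 -> A != [set: S]%SET ->
  exists s t, [/\ s \in A, t \notin A & adj s t].

(** Induction on the number of states outside the root set: take the lightest edge leaving [A],
    absorb its endpoint into the root set, and grow from there. *)
Lemma exists_growth_order (A : {set S}) :
  edge_connected -> A != finset.set0 -> exists n x, growth_order A n x.
Proof.
move=> conn; have [m] := ubnP #|~: A|; elim: m A => // m IH A.
move=> leAm A0; have [->|AT] := eqVneq A [set: S]%SET.
  exists (fun=> 0%N), (fun=> 0); split=> // s.
    by rewrite finset.in_setT.
    by move=> t l _; case: l.
have [s1 [t1 [s1A t1A st1]]] := conn _ A0 AT.
pose leaving (p : S * S) := [&& p.1 \in A, p.2 \notin A & adj p.1 p.2].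
have l1 : leaving (s1, t1) by rewrite /leaving s1A t1A.
have [[s0 t0] /= /and3P[/= s0A t0A st0] minw] :=
  @Order.TotalTheory.arg_minP _ _ _ (s1, t1) leaving (fun p => w p.1 p.2) l1.
have [||n [x [n0 npar ncut]]] := IH (t0 |: A).
- rewrite ltnS in leAm; apply: leq_trans leAm; apply: proper_card; apply/properP; split.
    by rewrite finset.setCS; apply: finset.subsetUr.
  by exists t0; rewrite !inE ?eqxx.
- by apply/set0Pn; exists t0; rewrite !inE eqxx.
have n't u : u \notin A -> u != t0 -> (0 < n u)%N.
  by move=> uA ut; rewrite lt0n n0 !inE negb_or ut.
(* The order grown from [t0 |: A] gives [t0] rank 0. It now gets rank 1, and all later ranks and
   weights shift by one. *)
exists (fun u => if u \in A then 0%N else if u == t0 then 1%N else (n u).+1).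
exists (fun l => if l == 1%N then w s0 t0 else x l.-1).
split.
- by move=> s; case: (s \in A) => //; case: (s == t0).
- move=> s; case: ifPn => // sA; case: eqVneq => [->|st] _.
    by exists s0; rewrite s0A.
  have ns := n't _ sA st; have [t [tn ts wt]] := npar _ ns.
  exists t; split=> //; first by do 2?case: ifP => // _.
  by rewrite eqSS (gtn_eqF ns).
- move=> s t l st; have [-> {l}|l1'] := eqVneq l 1%N.
    case: ifPn => sA; last by case: ifP.
    by case: ifPn => // tA _; apply: (minw (s, t)); rewrite /leaving sA tA.
  case: l l1' => [|l] //.
  rewrite eqSS => l0 /andP[sl lt]; apply: ncut => //; apply/andP; split.
    have nsE : (s \in A) || (s == t0) -> n s = 0%N.
      by move=> sE; apply/eqP; rewrite n0 !inE orbC.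
    move: sl; case: ifPn => [sA _|_]; first by rewrite nsE ?sA // lt0n.
    by case: ifPn => // sE _; rewrite nsE ?sE ?orbT // lt0n.
  move: lt; case: ifP => // _; case: ifP => // _.
  by rewrite ltnS leqn0 (negPf l0).
Qed.

(** The running maximum of [x 1, ..., x i]; the value [x 1] at [i = 0] keeps it monotone without
    involving [x 0]. *)
Fixpoint level (x : nat -> R) (i : nat) : R :=
  if i is j.+1 then Num.max (level x j) (x i) else x 1%N.

Lemma level_mono x : {homo level x : i j / (i <= j)%N >-> i <= j}.
Proof.
apply: homo_leq => //; first by move=> a b c; apply: le_trans.
by move=> i /=; rewrite le_max lexx.
Qed.

Lemma le_level x l i : (0 < l <= i)%N -> x l <= level x i.
Proof.
case: l => // l /andP[_ li]; apply: le_trans (level_mono x li).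
by rewrite /= le_max lexx orbT.
Qed.

Lemma level_attained x i : (0 < i)%N ->
  exists2 l, (0 < l <= i)%N & x l = level x i.
Proof.
elim: i => // -[|i] IH _; first by exists 1%N; rewrite //= maxxx.
have -> : level x i.+2 = Num.max (level x i.+1) (x i.+2) by [].
rewrite maxEle; case: ifP => _; first by exists i.+2; rewrite ?leqnn.
by have [//|l /andP[l0 li] <-] := IH; exists l; rewrite // l0 leqW.
Qed.

(* Both levels compute the minimax height of the paths joining [b] to [A]. *)
Lemma level_le_level (A : {set S}) n x n' x' b a :
  symmetric adj -> (forall s t, w s t = w t s) ->
  growth_order A n x -> growth_order [set b]%SET n' x' -> b \notin A -> a \in A ->
  level x (n b) <= level x' (n' a).
Proof.
move=> adjC wC [n0 npar ncut] [n'0 n'par n'cut] bA aA.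
have nb : (0 < n b)%N by rewrite lt0n n0.
have [l /andP[l0 lb] <-] := level_attained x nb.
rewrite leNgt; apply/negP => lt_level.
(* In the second order, the parent path from [a] to [b] uses only edges lighter than [x l]. Such
   edges cannot cross rank [l] of the first order, and [b] lies at or above it, so [a] would too,
   although its rank is 0. *)
suff high m s : (n' s < m)%N -> (n' s <= n' a)%N -> (l <= n s)%N.
  have := high _ a (leqnn _) (leqnn _).
  by move: aA; rewrite -n0 => /eqP ->; rewrite leqNgt l0.
elim: m s => // m IH s sm sa; have [n's|n's] := posnP (n' s).
  by move/eqP: n's; rewrite n'0 inE => /eqP ->.
have [t [ts adjts wts]] := n'par _ n's.
have lt : (l <= n t)%N.
  by apply: IH; [apply: leq_trans ts _ | apply: ltnW; apply: leq_trans ts _].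
rewrite leqNgt; apply/negP => sl.
have := ncut s t l; rewrite adjC adjts sl lt => /(_ isT isT).
rewrite wC wts leNgt => /negP; apply; apply: le_lt_trans lt_level.
by apply: le_level; rewrite n's.
Qed.

End growth_order.

(** * Annealing kernels and the potential *)

Section drift.
Variables (R : realType) (S : finType) (adj : rel S) (H : S -> R).

Definition barrier (s t : S) : R := Num.max (H s) (H t).

(** The interface between the potential argument and the concrete dynamics: any selection rule
    within a constant factor [c] of Metropolis acceptance fits. *)
Definition annealing_kernel (c beta : R) (P : S -> S -> R) :=
  [/\ forall s t, 0 <= P s t,
      forall s, \sum_t P s t = 1,
      forall s t, t != s -> ~~ adj s t -> P s t = 0
    & forall s t, adj s t ->
        c * expR (- (beta * (barrier s t - H s))) <= P s t
          <= expR (- (beta * (barrier s t - H s)))].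

(** The solution [q] of [N q / (1 - q) = c / 2], with [N] the number of states: all climbs from rank
    [j] together then weigh at most half of the descent [c q^j] to the parent. *)
Definition damping (c : R) : R := (1 + 2 * #|S|%:R / c)^-1.

(** The potential as a function of the rank; it is used with [E = level x i] and
    [m = minn i (n s)]. *)
Definition climb (q E : R) (x : nat -> R) (beta : R) (m : nat) : R :=
  \sum_(0 <= l < m) q ^+ l.+1 * expR (- (beta * (E - x l.+1))).

Section damping.
Variable c : R.
Hypothesis c01 : 0 < c <= 1.

Lemma damping_gt0 : 0 < damping c.
Proof.
have /andP[c0 _] := c01; rewrite invr_gt0 addrC ltr_wpDl //.
by rewrite mulr_ge0 ?invr_ge0 ?(ltW c0) // mulr_ge0.
Qed.

Lemma damping_tail : #|S|%:R * damping c = c / 2 * (1 - damping c).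
Proof.
have /andP[c0 _] := c01; have N0 : 0 <= #|S|%:R :> R by []; rewrite /damping; field.
by rewrite !gt_eqF //; lra.
Qed.

Lemma damping_le1 : damping c <= 1.
Proof.
have /andP[c0 _] := c01; rewrite -subr_ge0.
have : 0 <= c / 2 * (1 - damping c).
  by rewrite -damping_tail mulr_ge0 // ltW // damping_gt0.
by rewrite pmulr_rge0 // divr_gt0.
Qed.

Lemma damping_sum j i :
  #|S|%:R * \sum_(j <= l < i) damping c ^+ l.+1 <= c / 2 * damping c ^+ j.
Proof.
have /andP[c0 _] := c01; have q0 := damping_gt0.
have [ij|ji] := leqP i j.
  by rewrite big_geq // mulr0 mulr_ge0 ?exprn_ge0 ?ltW // divr_gt0.
suff -> : #|S|%:R * \sum_(j <= l < i) damping c ^+ l.+1 =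
    c / 2 * (damping c ^+ j - damping c ^+ i).
  rewrite ler_wpM2l //; first by rewrite ltW // divr_gt0.
  by rewrite lerBlDr lerDl exprn_ge0 // ltW.
under eq_bigr do rewrite exprS.
rewrite -mulr_sumr mulrA damping_tail -mulrA; congr (_ * _).
rewrite mulr_sumr [RHS](_ : _ = - (damping c ^+ i - damping c ^+ j)); last by ring.
rewrite -telescope_sumr ?(ltnW ji) // -sumrN; apply: eq_bigr => l _.
by rewrite exprS; ring.
Qed.

End damping.

Lemma climb_mono (q E : R) x beta m m' : 0 <= q -> (m <= m')%N ->
  climb q E x beta m <= climb q E x beta m'.
Proof.
move=> q0 mm'; rewrite /climb (big_cat_nat _ mm') //= lerDl.
by apply: sumr_ge0 => l _; rewrite mulr_ge0 ?exprn_ge0 ?expR_ge0.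
Qed.

Lemma climb_ge0 (q E : R) x beta m : 0 <= q -> 0 <= climb q E x beta m.
Proof. by move=> q0; apply: sumr_ge0 => l _; rewrite mulr_ge0 ?exprn_ge0 ?expR_ge0. Qed.

(** No [x l] with [l <= i] exceeds [level x i], so every exponent decreases with [beta]. This lets
    one potential serve while the temperature changes. *)
Lemma climb_antimono (q : R) x beta beta' i m : 0 <= q -> (m <= i)%N -> beta <= beta' ->
  climb q (level x i) x beta' m <= climb q (level x i) x beta m.
Proof.
move=> q0 mi bb'; apply: ler_sum_nat => l /andP[_ lm].
rewrite ler_wpM2l ?exprn_ge0 // ler_expR lerN2 ler_wpM2r // subr_ge0.
by apply: le_level; rewrite /= (leq_trans lm).
Qed.

(** The summand whose weight attains the level has exponent 0. *)
Lemma climb_ge (q : R) x beta i m : 0 <= q <= 1 -> (0 < i <= m)%N ->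
  q ^+ i <= climb q (level x i) x beta m.
Proof.
move=> /andP[q0 q1] /andP[i0 im]; have [[//|l] /andP[_ li] <-] := level_attained x i0.
have lm : (l < m)%N by apply: leq_trans im.
rewrite /climb (bigD1_seq l) ?mem_index_iota ?iota_uniq //= subrr mulr0 oppr0 expR0 mulr1.
apply: le_trans (_ : q ^+ l.+1 <= _); first exact: ler_wiXn2l.
by rewrite lerDl; apply: sumr_ge0 => k _; rewrite mulr_ge0 ?exprn_ge0 ?expR_ge0.
Qed.

Lemma climb_le (c E : R) x (beta : R) m : 0 < c <= 1 -> (0 < #|S|)%N -> 0 <= beta ->
  climb (damping c) E x beta m <= expR (- (beta * (E - level x m))).
Proof.
move=> c01 S0 b0; have q0 := damping_gt0 c01; have /andP[c0 c1] := c01.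
have sum1 : \sum_(0 <= l < m) damping c ^+ l.+1 <= 1.
  have := damping_sum c01 0 m; rewrite expr0 mulr1.
  have : 1 <= #|S|%:R :> R by rewrite ler1n.
  have : 0 <= \sum_(0 <= l < m) damping c ^+ l.+1.
    by apply: sumr_ge0 => l _; rewrite exprn_ge0 // ltW.
  nra.
apply: le_trans (_ : (\sum_(0 <= l < m) damping c ^+ l.+1) *
                     expR (- (beta * (E - level x m))) <= _); last first.
  by rewrite ler_piMl ?expR_ge0.
rewrite mulr_suml; apply: ler_sum_nat => l /andP[_ lm].
rewrite ler_wpM2l ?exprn_ge0 ?(ltW q0) // ler_expR lerN2 ler_wpM2l // lerB //.
by apply: le_level.
Qed.

Section kernel.
Variables (c beta : R) (P : S -> S -> R) (n : S -> nat) (x : nat -> R) (A : {set S}).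
Hypotheses (c01 : 0 < c <= 1) (beta0 : 0 <= beta).
Hypotheses (PK : annealing_kernel c beta P) (adjC : symmetric adj).
Hypothesis order_n : growth_order adj barrier A n x.
Variables (E : R) (i : nat).

Let q := damping c.
Let g s := climb q E x beta (minn i (n s)).

(** From rank [i] on, [g] is at its maximum, so no transition increases it. *)
Lemma climb_drift_top s : (i <= n s)%N -> \sum_t P s t * g t <= g s.
Proof.
have [P0 P1 _ _] := PK; move=> ins.
rewrite -[leRHS]mul1r -(P1 s) mulr_suml; apply: ler_sum => t _.
rewrite ler_wpM2l // climb_mono ?(ltW (damping_gt0 c01)) //.
by rewrite (minn_idPl ins) geq_minl.
Qed.

(** Each climb gains at most [e] times a geometric tail, [c / 2 * q ^+ n s * e] over all targets,
    while the descent to the parent loses [c * q ^+ n s * e]. A root has no parent, whence the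
    indicator. *)
Lemma climb_drift s : (n s <= i)%N ->
  \sum_t P s t * g t <= g s + expR (- (beta * (E - H s)))
                              * ((c / 2 - (n s != 0)%N%:R * c) * q ^+ n s).
Proof.
have [P0 P1 Pnadj Padj] := PK; have [n0 npar ncut] := order_n.
have q0 : 0 < q := damping_gt0 c01; have /andP[c0 c1] := c01.
move=> nsi; set e := expR _; have e0 : 0 < e by apply: expR_gt0.
pose T := \sum_(n s <= l < i) q ^+ l.+1.
have T0 : 0 <= T by apply: sumr_ge0 => l _; rewrite exprn_ge0 // ltW.
have qT : #|S|%:R * T <= c / 2 * q ^+ n s := damping_sum c01 (n s) i.
have step t : P s t * (g t - g s) <= e * T.
  have [tns|sns] := leqP (n t) (n s).
    apply: le_trans (_ : 0 <= _); last by rewrite mulr_ge0 // ltW.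
    rewrite mulr_ge0_le0 // subr_le0 climb_mono ?(ltW q0) //.
    by rewrite leq_min geq_minl (leq_trans (geq_minr _ _)).
  have ts : t != s by apply: contraTneq sns => ->; rewrite ltnn.
  have [adjst|nadj] := boolP (adj s t); last first.
    by rewrite Pnadj // mul0r mulr_ge0 // ltW.
  have /andP[_ Pst] := Padj _ _ adjst.
  have ms : (n s <= minn i (n t))%N by rewrite leq_min nsi ltnW.
  rewrite /g (minn_idPr nsi) /climb (big_cat_nat _ ms) //= addrAC subrr add0r.
  apply: le_trans (_ : \sum_(n s <= l < minn i (n t)) e * q ^+ l.+1 <= _); last first.
    rewrite -mulr_sumr ler_wpM2l ?(ltW e0) // /T [leRHS](big_cat_nat ms) ?geq_minl //=.
    by rewrite lerDl; apply: sumr_ge0 => l _; rewrite exprn_ge0 // ltW.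
  rewrite mulr_sumr; apply: ler_sum_nat => l /andP[sl lt].
  rewrite mulrCA [leRHS]mulrC ler_wpM2l ?exprn_ge0 ?(ltW q0) //.
  apply: le_trans (ler_wpM2r (expR_ge0 _) Pst) _.
  rewrite -expRD ler_expR -opprD -mulrDr lerN2 ler_wpM2l //.
  (* The cut property: a climb past rank [l.+1] has already paid at least [x l.+1] in its transition
     probability. *)
  have : x l.+1 <= barrier s t.
    by apply: ncut; rewrite // ltnS sl (leq_trans lt) ?geq_minr.
  lra.
have -> : \sum_t P s t * g t = g s + \sum_t P s t * (g t - g s).
  under [in RHS]eq_bigr do rewrite mulrBr.
  by rewrite sumrB -mulr_suml P1 mul1r addrC subrK.
rewrite lerD2l.
have all_le (Q : pred S) : \sum_(t | Q t) P s t * (g t - g s) <= e * (#|S|%:R * T).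
  apply: le_trans (_ : \sum_(t | Q t) e * T <= _); first by apply: ler_sum.
  rewrite sumr_const -[leLHS]mulr_natl mulrCA ler_wpM2l ?(ltW e0) // ler_wpM2r // ler_nat.
  exact: max_card.
have [ns0|ns0] := eqVneq (n s) 0%N.
  apply: le_trans (all_le predT) _; rewrite ler_wpM2l ?(ltW e0) //.
  by rewrite mul0r subr0.
have ns : (0 < n s)%N by rewrite lt0n.
have [t0 [ts0 adjts0 wts0]] := npar _ ns.
rewrite (bigD1 t0) //= mul1r.
have adjst0 : adj s t0 by rewrite adjC.
have /andP[Pst0 _] := Padj _ _ adjst0.
(* The barrier to the parent equals [x (n s)], so the transition probability and the last summand of
   [g s] multiply to exactly [c * q ^+ n s * e]. *)
have parent : P s t0 * (g t0 - g s) <= - (e * (c * q ^+ n s)).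
  have gt0s : g t0 - g s <= - (q ^+ n s * expR (- (beta * (E - x (n s))))).
    rewrite /g (minn_idPr nsi) (minn_idPr (ltnW (leq_trans ts0 nsi))).
    have : climb q E x beta (n t0) <= climb q E x beta (n s).-1.
      by apply: climb_mono; rewrite ?(ltW q0) // -ltnS prednK.
    have -> : climb q E x beta (n s) = climb q E x beta (n s).-1 +
        q ^+ n s * expR (- (beta * (E - x (n s)))).
      by rewrite -{1}(prednK ns) /climb big_nat_recr //= (prednK ns).
    lra.
  apply: le_trans (ler_wpM2l (P0 _ _) gt0s) _.
  rewrite mulrN lerN2.
  apply: le_trans (ler_wpM2r _ Pst0); last by rewrite mulr_ge0 ?exprn_ge0 ?expR_ge0 ?ltW.
  rewrite /e; have -> : E - H s = (barrier s t0 - H s) + (E - x (n s)).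
    by rewrite -wts0 /barrier maxC; ring.
  by rewrite mulrDr opprD expRD le_eqVlt; apply/orP; left; apply/eqP; ring.
have := all_le (fun t => t != t0).
move: parent; rewrite !mulrDl; nra.
Qed.

End kernel.
End drift.

(** * Inhomogeneous chains *)

(** From a time [K] after which [eta <= e / 2], unrolling leaves [e / 2] plus [a K] damped by the
    product of the [1 - t k], itself at most the exponential of minus a divergent sum. *)
Lemma contraction_cvg0 (R : realType) (a t eta : nat -> R) :
  (forall k, 0 <= a k) -> (forall k, 0 <= t k <= 1) ->
  (forall k, a k.+1 <= (1 - t k) * a k + t k * eta k) ->
  eta k @[k --> \oo] --> 0 ->
  (forall B, exists n, B <= \sum_(0 <= k < n) t k) ->
  a k @[k --> \oo] --> 0.
Proof.
move=> a0 t01 arec eta0 tdiv; apply/cvgr0Pnorm_le => e e0.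
have e20 : 0 < e / 2 by rewrite divr_gt0.
have /cvgr0Pnorm_le /(_ _ e20) [K _ etaK] := eta0.
pose s m := \sum_(K <= k < K + m) t k.
have decay m : a (K + m)%N <= e / 2 + a K * expR (- s m).
  elim: m => [|m IH].
    by rewrite addn0 /s addn0 big_geq // oppr0 expR0 mulr1 lerDr ltW.
  rewrite addnS; apply: le_trans (arec _) _.
  have := etaK (K + m)%N (leq_addr _ _); rewrite /= ler_norml => /andP[_ etam].
  have /andP[tm0 tm1] := t01 (K + m)%N.
  have -> : expR (- s m.+1) = expR (- s m) * expR (- t (K + m)%N).
    by rewrite /s addnS big_nat_recr ?leq_addr //= opprD expRD.
  have tE : 1 - t (K + m)%N <= expR (- t (K + m)%N) by apply: expR_ge1Dx.
  have sE := mulr_ge0 (a0 K) (expR_ge0 (- s m)).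
  have := ler_wpM2l sE tE.
  move: IH etam; set A := a (K + m)%N; set T := t (K + m)%N; set X := a K * _.
  rewrite mulrA -/X => IH etam XT.
  have : (1 - T) * A <= (1 - T) * (e / 2 + X) by rewrite ler_wpM2l // subr_ge0.
  have : T * eta (K + m)%N <= T * (e / 2) by rewrite ler_wpM2l.
  lra.
(* Past this threshold the sum [x] from [K] satisfies [a K <= x * (e / 2)], and
   [x * expR (- x) <= 1] gives the other [e / 2]. *)
have [N tN] := tdiv (2 * a K / e + \sum_(0 <= k < K) t k).
exists (K + N)%N => // k /= KNk; rewrite ger0_norm //.
have -> : k = (K + (k - K))%N by rewrite subnKC // (leq_trans (leq_addr _ _) KNk).
apply: le_trans (decay _) _.
have sk : 2 * a K / e <= s (k - K)%N.
  have Kk : (K <= k)%N by apply: leq_trans (leq_addr _ _) KNk.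
  have Nk : (N <= k)%N by apply: leq_trans (leq_addl _ _) KNk.
  rewrite /s subnKC // -(lerD2r (\sum_(0 <= l < K) t l)); apply: le_trans tN _.
  rewrite addrC -(big_cat_nat (leq0n _) Kk) /= (big_cat_nat (leq0n _) Nk) /= lerDl.
  by apply: sumr_ge0 => l _; have /andP[] := t01 l.
set x := s _ in sk *.
have x0 : 0 <= x by apply: le_trans sk; rewrite divr_ge0 ?mulr_ge0 // ltW.
have aKx : a K <= x * (e / 2).
  by move: sk; rewrite ler_pdivrMr // => sk; lra.
have : a K * expR (- x) <= e / 2.
  apply: le_trans (ler_wpM2r (expR_ge0 _) aKx) _.
  have := expR_ge1Dx x; have := expRxMexpNx_1 x; have := expR_gt0 (- x).
  have := expR_gt0 x; set y := expR x; set z := expR (- x) => y0 z0 yz xy.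
  have xz : x * z <= 1 by rewrite -yz ler_wpM2r ?(ltW z0) //; lra.
  nra.
lra.
Qed.

Section chain.
Variables (R : realType) (S : finType) (adj : rel S) (H : S -> R) (c : R).
Variables (beta : nat -> R) (P : nat -> S -> S -> R).
Hypotheses (c01 : 0 < c <= 1) (adjC : symmetric adj).
Hypothesis cool : cooling_schedule beta.
Hypothesis PK : forall k, annealing_kernel adj H c (beta k.+1) (P k.+1).

Let q := damping S c.
Let q0 : 0 < q := damping_gt0 S c01.
Let q1 : q <= 1 := damping_le1 S c01.
Let q01 : 0 <= q <= 1. Proof. by rewrite ltW. Qed.

(* [mu k] is the distribution at time [K + k]. *)
Definition evolves (K : nat) (mu : nat -> S -> R) :=
  [/\ forall k s, 0 <= mu k s, forall k, \sum_s mu k s = 1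
    & forall k t, mu k.+1 t = \sum_s mu k s * P (K + k).+1 s t].

Let beta_gt0 k : 0 < beta k.+1. Proof. by have [+ _ _] := cool; apply. Qed.

Let beta_mono k : beta k.+1 <= beta k.+2.
Proof. by have [_ + _] := cool; apply. Qed.

Let beta_cvg d : 0 < d -> expR (- (beta k.+1 * d)) @[k --> \oo] --> 0.
Proof.
move=> d0; have [_ _ binf] := cool.
apply: (cvg_comp (fun k => beta k.+1 * d) (fun y : R => expR (- y)) _ (@cvgr_expR R)).
apply/cvgryPge => B; have /cvgryPge /(_ (B / d)) [N _ NB] := binf.
exists N => // k /= Nk; rewrite -ler_pdivrMr //; apply: NB; exact: leqW.
Qed.

Section potential.
Variables (K : nat) (mu : nat -> S -> R) (n : S -> nat) (x : nat -> R) (i : nat).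
Hypothesis muP : evolves K mu.

Let g k s := climb q (level x i) x (beta (K + k).+1) (minn i (n s)).

Definition potential k := \sum_s mu k s * g k s.

Lemma potential_ge0 k : 0 <= potential k.
Proof.
have [mu0 _ _] := muP; apply: sumr_ge0 => s _.
by rewrite mulr_ge0 // climb_ge0 // ltW.
Qed.

(** Move the chain with [g] frozen at time [k]; then updating [beta] only lowers [g]. *)
Lemma potential_step k :
  potential k.+1 <= \sum_s mu k s * \sum_t P (K + k).+1 s t * g k t.
Proof.
have [mu0 _ murec] := muP.
under [leRHS]eq_bigr do rewrite mulr_sumr.
rewrite exchange_big /=; apply: ler_sum => t _.
under [leRHS]eq_bigr do rewrite mulrA.
rewrite -mulr_suml -murec ler_wpM2l // climb_antimono ?(ltW q0) ?geq_minl //.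
by rewrite addnS.
Qed.

Lemma mass_le_potential k : (0 < i)%N ->
  q ^+ i * \sum_(s | (i <= n s)%N) mu k s <= potential k.
Proof.
have [mu0 _ _] := muP; move=> i0.
rewrite mulr_sumr /potential [leRHS](bigID (fun s => (i <= n s)%N)) /= -[leLHS]addr0.
rewrite lerD //; last by apply: sumr_ge0 => s _; rewrite mulr_ge0 // climb_ge0 // ltW.
apply: ler_sum => s ins; rewrite mulrC ler_wpM2l // /g (minn_idPl ins).
by rewrite climb_ge // i0 leqnn.
Qed.

End potential.

(** Sufficiency, by downward induction on the rank: the potential truncated at [i] contracts at a
    non-summable rate, forced only by the mass above [i] and by a vanishing contribution of the
    roots. *)
Lemma mass_above_cvg0 (A : {set S}) n x mu (Hmin delta gamma : R) :
  growth_order adj (barrier H) A n x -> evolves 0 mu ->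
  (forall s, s \in A -> H s = Hmin) ->
  0 < delta -> (forall s, s \notin A -> Hmin + delta <= H s) ->
  0 <= gamma -> (forall s, s \notin A -> level x (n s) - H s <= gamma) ->
  (forall B, exists N, B <= \sum_(0 <= k < N) expR (- (beta k.+1 * gamma))) ->
  forall i, (0 < i)%N -> \sum_(s | (i <= n s)%N) mu k s @[k --> \oo] --> 0.
Proof.
move=> order_n muP HA delta0 HnA gamma0 gammaP sum_div.
have [n0 npar _] := order_n; have [mu0 mu1 _] := muP; have /andP[c0 c1] := c01.
suff main m i : (0 < i)%N -> (\max_s n s < i + m)%N ->
    \sum_(s | (i <= n s)%N) mu k s @[k --> \oo] --> 0.
  by move=> i i0; apply: (main (\max_s n s).+1) => //; rewrite addnS ltnS leq_addl.
elim: m i => [|m IH] i i0 im.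
  rewrite (_ : (fun _ => _) = fun=> 0); first exact: cvg_cst.
  apply/funext => k; apply: big_pred0 => s; apply/negbTE; rewrite -ltnNge.
  by apply: leq_ltn_trans (leq_bigmax s) _; rewrite addn0 in im.
have {im IH} above : \sum_(s | (i < n s)%N) mu k s @[k --> \oo] --> 0.
  by apply: IH => //; rewrite addSnnS.
have [/existsP[s0 /eqP ns0]|/existsPn noi] := boolP [exists s, n s == i]; last first.
  suff -> : (fun k => \sum_(s | (i <= n s)%N) mu k s) =
            (fun k => \sum_(s | (i < n s)%N) mu k s) by [].
  apply/funext => k; apply: eq_bigl => s.
  by rewrite ltn_neqAle eq_sym noi.
(* The rate [expR (- (beta * d))] needs [d <= gamma] to be non-summable, [d <= E - Hmin - delta] to
   dominate the drift at the roots, and [d >= level x (n s) - H s] at the other states of rank at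
   most [i]. The minimum meets all three. *)
set E := level x i; pose d := Num.min gamma (E - Hmin - delta).
have s0A : s0 \notin A by rewrite -n0 ns0 -lt0n.
have S0 : (0 < #|S|)%N by apply/card_gt0P; exists s0.
have Hs0E : H s0 <= E.
  have [|t [_ _ wt]] := npar s0; first by rewrite ns0.
  apply: le_trans (_ : x (n s0) <= _); first by rewrite -wt le_max lexx orbT.
  by rewrite ns0; apply: le_level; rewrite i0 leqnn.
have d0 : 0 <= d.
  rewrite le_min gamma0 /=; have := HnA _ s0A; lra.
have dgamma : d <= gamma by rewrite ge_min lexx.
have dE : d <= E - Hmin - delta by rewrite ge_min lexx orbT.
have qi0 : 0 < q ^+ i by rewrite exprn_gt0.
have qi1 : q ^+ i <= 1 by rewrite exprn_ile1 // ltW.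
pose kappa := c / 2 * q ^+ i.
have kappa0 : 0 < kappa by rewrite mulr_gt0 // divr_gt0.
pose t k := kappa * expR (- (beta k.+1 * d)).
pose eta k := \sum_(s | (i < n s)%N) mu k s + (q ^+ i)^-1 * expR (- (beta k.+1 * delta)).
have drift s k : (\sum_t P k.+1 s t * climb q E x (beta k.+1) (minn i (n t)) <=
    (1 - t k) * climb q E x (beta k.+1) (minn i (n s)) + t k *
    ((i < n s)%N%:R + (q ^+ i)^-1 * expR (- (beta k.+1 * delta)))).
  have b0 := ltW (beta_gt0 k); rewrite /t; set b := beta k.+1 in b0 *.
  set D := expR (- (b * delta)); have D0 : 0 <= D by apply: expR_ge0.
  set u := kappa * _; have u0 : 0 <= u by rewrite mulr_ge0 ?expR_ge0 // ltW.
  have uD : 0 <= u * ((q ^+ i)^-1 * D) by rewrite mulr_ge0 // mulr_ge0 // invr_ge0 ltW.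
  (* Above rank [i] there is no contraction, but [g <= 1], so the indicator term compensates. At a
     root [g] vanishes and the [delta] term covers the drift; elsewhere the drift itself is at most
     [- u * g]. *)
  have [is_|si] := ltnP i (n s).
    apply: le_trans (climb_drift_top _ c01 (PK k) _ (ltnW is_)) _.
    rewrite /= (minn_idPl (ltnW is_)) -/q -/b; set G := climb _ _ _ _ _.
    have G1 : G <= 1.
      apply: le_trans (climb_le _ _ _ c01 S0 b0) _.
      by rewrite subrr mulr0 oppr0 expR0.
    have := mulr_ge0 u0 (_ : 0 <= 1 - G); rewrite subr_ge0 => /(_ G1).
    by rewrite mulrDr mulr1n mulr1; lra.
  apply: le_trans (climb_drift c01 b0 (PK k) adjC order_n _ si) _.
  have [ns|ns] := eqVneq (n s) 0%N.
    rewrite ns minn0 /climb big_geq // !mulr0 !add0r mul0r subr0 expr0 mulr1.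
    have -> : u * ((q ^+ i)^-1 * D) = c / 2 * (expR (- (b * d)) * D).
      by rewrite /u /kappa; field; rewrite gt_eqF.
    rewrite mulrC ler_wpM2l ?divr_ge0 ?(ltW c0) // -expRD ler_expR -opprD -mulrDr.
    rewrite lerN2 ler_wpM2l // HA; first lra.
    by rewrite -n0 ns.
  have sA : s \notin A by rewrite -n0.
  rewrite (minn_idPr si) mul1r; set G := climb _ _ _ _ _.
  suff : u * G <= expR (- (b * (E - H s))) * (c / 2 * q ^+ n s).
    by move: uD; rewrite mulr0n add0r => uD uG; lra.
  have Gle : G <= expR (- (b * (E - level x (n s)))) by apply: climb_le.
  apply: le_trans (ler_wpM2l u0 Gle) _.
  rewrite /u -[leLHS]mulrA -expRD [leLHS]mulrC ler_pM ?expR_ge0 ?(ltW kappa0) //.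
    rewrite ler_expR -opprD -mulrDr lerN2 ler_wpM2l //.
    suff : level x (n s) - H s <= d by lra.
    rewrite le_min gammaP //=; have := level_mono x si; have := HnA _ sA.
    rewrite -/E; lra.
  by rewrite /kappa ler_wpM2l ?divr_ge0 ?(ltW c0) // ler_wiXn2l // ltW.
have pot_cvg : potential 0 mu n x i k @[k --> \oo] --> 0.
  apply: (@contraction_cvg0 _ _ t eta).
  - by move=> k; apply: potential_ge0.
  - move=> k; rewrite mulr_ge0 ?expR_ge0 ?(ltW kappa0) //=.
    rewrite mulr_ile1 ?expR_ge0 ?(ltW kappa0) //.
      by rewrite /kappa mulr_ile1 ?(ltW qi0) ?divr_ge0 ?(ltW c0) //; lra.
    by rewrite expR_le1 oppr_le0 mulr_ge0 // ltW.
  - move=> k; apply: le_trans (potential_step _ _ _ muP _) _.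
    rewrite add0n; apply: le_trans (_ : \sum_s mu k s * _ <= _).
      by apply: ler_sum => s _; apply: ler_wpM2l (drift s k).
    under eq_bigr do rewrite mulrDr mulrCA (mulrCA _ (t k)).
    rewrite big_split /= -!mulr_sumr lerD2l ler_wpM2l //.
      by rewrite mulr_ge0 ?expR_ge0 // ltW.
    under eq_bigr do rewrite mulrDr.
    rewrite big_split /= -mulr_suml mu1 mul1r lerD2r.
    by under eq_bigr do rewrite mulr_natr mulrb; rewrite -big_mkcond.
  - rewrite -[0]addr0; apply: cvgD => //; rewrite -[0](mulr0 (q ^+ i)^-1).
    by apply: cvgM; [apply: cvg_cst | apply: beta_cvg].
  - move=> B; have [N NB] := sum_div (B / kappa); exists N.
    rewrite -mulr_sumr mulrC -ler_pdivrMr //; apply: le_trans NB _.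
    apply: ler_sum => k _; rewrite ler_expR lerN2 ler_wpM2l //.
    by rewrite ltW.
apply: (@squeeze_cvgr _ _ _ _ (fun=> 0) (fun k => (q ^+ i)^-1 * potential 0 mu n x i k)).
- apply: nearW => k; rewrite sumr_ge0 //= mulrC ler_pdivlMr // mulrC.
  exact: mass_le_potential.
- exact: cvg_cst.
- by rewrite -[0](mulr0 (q ^+ i)^-1); apply: cvgM => //; apply: cvg_cst.
Qed.

(** Mass present anywhere at time [K] flows to [b] along parent edges, each taken with positive
    probability. *)
Lemma reaches_root b n x mu K : evolves 0 mu ->
  growth_order adj (barrier H) [set b]%SET n x -> exists2 K', (K <= K')%N & 0 < mu K' b.
Proof.
move=> [mu0 mu1 murec] [n0 npar _]; have /andP[c0 _] := c01.
have [s mus] : exists s, 0 < mu K s.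
  apply/not_existsP => mus; have : \sum_s mu K s <= 0.
    by apply: sumr_le0 => s _; rewrite leNgt; apply/negP/mus.
  by rewrite mu1 ler10.
have [m] := ubnP (n s); elim: m s K mus => // m IH s K mus nsm.
have [ns|ns] := posnP (n s).
  by exists K => //; move/eqP: ns; rewrite n0 finset.in_set1 => /eqP <-.
have [t [ts adjts _]] := npar _ ns.
have [||K' KK' muK'] := IH t K.+1; last by exists K' => //; apply: ltnW.
- rewrite murec (bigD1 s) //=; apply: ltr_wpDr.
    have [P0 _ _ _] := PK K.
    by apply: sumr_ge0 => u _; rewrite mulr_ge0.
  have [_ _ _ Padj] := PK K.
  have adjst : adj s t by rewrite adjC.
  have /andP[+ _] := Padj _ _ adjst.
  by move/(lt_le_trans _) => Pst; rewrite mulr_gt0 // Pst // mulr_gt0 ?expR_gt0.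
- by apply: leq_trans ts _.
Qed.

(* The chain restarted at [b] at a late time [K] is at each later time below
   rank [i] with probability at least 1/2, and [p] is half the mass of [b] at [K]. *)
Lemma mass_below_bounded b n x mu i : (0 < i)%N -> evolves 0 mu ->
  growth_order adj (barrier H) [set b]%SET n x ->
  (forall e, 0 < e -> exists K, forall K' m, (K <= K')%N ->
     \sum_(0 <= k < m) expR (- (beta (K' + k).+1 * (level x i - H b))) <= e) ->
  exists p K, 0 < p /\ forall k, (K <= k)%N -> p <= \sum_(s | (n s < i)%N) mu k s.
Proof.
move=> i0 muP order_n tail; have /andP[c0 c1] := c01.
have [mu0 mu1 murec] := muP; have [n0 _ _] := order_n.
have qi0 : 0 < q ^+ i by rewrite exprn_gt0.
(* A restarted potential of at most [q ^+ i / 2] bounds the mass at ranks [i] and above by 1/2. *)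
have [|K0 K0P] := tail (q ^+ i / 2); first by rewrite divr_gt0.
have [K K0K muK] := reaches_root K0 muP order_n.
(* The chain restarted at [b] at time [K]; by linearity its law times [mu K b] stays below [mu]. *)
pose rho := fix rho j : S -> R := if j is j'.+1
  then fun t => \sum_s rho j' s * P (K + j').+1 s t else fun t => (t == b)%:R.
have rhoP : evolves K rho.
  split=> //.
  - elim=> [|k IH] s /=; first exact: ler0n.
    by apply: sumr_ge0 => t _; have [P0 _ _ _] := PK (K + k); rewrite mulr_ge0.
  - elim=> [|k IH] /=.
      by rewrite (bigD1 b) //= eqxx big1 ?addr0 // => s /negPf ->.
    rewrite exchange_big /= -[RHS]IH; apply: eq_bigr => s _.
    by have [_ P1 _ _] := PK (K + k); rewrite -mulr_sumr P1 mulr1.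
have [rho0 rho1 _] := rhoP.
have mu_ge k s : mu K b * rho k s <= mu (K + k)%N s.
  elim: k s => [|k IH] s; rewrite ?addn0 /=.
    by have [->|_] := eqVneq s b; rewrite ?mulr1 // mulr0.
  rewrite addnS murec mulr_sumr; apply: ler_sum => t _.
  by rewrite mulrA ler_wpM2r //; have [P0 _ _ _] := PK (K + k); apply: P0.
set E := level x i in tail K0P.
(* Only [b] has a positive drift, and the potential starts from 0 there, so it never exceeds the
   summed tail. *)
have drift s k : \sum_t P (K + k).+1 s t * climb q E x (beta (K + k).+1) (minn i (n t))
    <= climb q E x (beta (K + k).+1) (minn i (n s)) + expR (- (beta (K + k).+1 * (E - H b))).
  have b0 := ltW (beta_gt0 (K + k)); set e := expR _.
  have e0 : 0 <= e by apply: expR_ge0.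
  have [is_|si] := leqP i (n s).
    apply: le_trans (climb_drift_top _ c01 (PK _) _ is_) _.
    by rewrite (minn_idPl is_) lerDl.
  apply: le_trans (climb_drift c01 b0 (PK _) adjC order_n _ (ltnW si)) _.
  rewrite /= (minn_idPr (ltnW si)) lerD2l; have [ns|ns] := eqVneq (n s) 0%N.
    move/eqP: (ns); rewrite n0 finset.in_set1 ns => /eqP ->.
    by rewrite -/e mul0r subr0 expr0 mulr1 ler_piMr //; lra.
  apply: le_trans e0; rewrite mulr_ge0_le0 ?expR_ge0 // mulr_le0_ge0 ?exprn_ge0 ?(ltW q0) //.
  by rewrite mul1r; lra.
have pot_le k : potential K rho n x i k <= q ^+ i / 2.
  apply: le_trans (K0P K k K0K).
  elim: k => [|k IH].
    rewrite big_geq // /potential (bigD1 b) //= eqxx big1 ?addr0; last first.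
      by move=> s /negPf ->; rewrite mul0r.
    have -> : n b = 0%N by apply/eqP; rewrite n0 finset.in_set1.
    by rewrite minn0 /climb big_geq // mulr0.
  rewrite big_nat_recr //=; apply: le_trans (potential_step _ _ _ rhoP _) _.
  apply: le_trans (lerD IH (lexx _)); rewrite -[X in _ <= _ + X]mul1r -(rho1 k).
  rewrite mulr_suml -big_split /=; apply: ler_sum => s _.
  by rewrite -mulrDr ler_wpM2l.
exists (mu K b / 2), K; split; first by rewrite divr_gt0.
move=> k Kk; rewrite -(subnKC Kk); set j := (k - K)%N.
apply: le_trans (_ : \sum_(s | (n s < i)%N) mu K b * rho j s <= _); last first.
  by apply: ler_sum => s _.
rewrite -mulr_sumr ler_wpM2l //.
have := le_trans (mass_le_potential n x rhoP j i0) (pot_le j).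
rewrite ler_pM2l // => above.
have := rho1 j; rewrite (bigID (fun s => (i <= n s)%N)) /=.
under [X in _ + X = _]eq_bigl do rewrite -ltnNge.
move: above; lra.
Qed.

End chain.

(** * The Digital Annealer *)

Section independent_trials.
Variables (R : realType) (V : finType) (a : V -> R).
Hypothesis a01 : forall x, 0 <= a x <= 1.

Definition trial_weight (T : {set V}) : R :=
  (\prod_(y in T) a y) * (\prod_(y in ~: T) (1 - a y)).

Lemma trial_weight_ge0 T : 0 <= trial_weight T.
Proof.
by apply: mulr_ge0; apply: prodr_ge0 => y _; have /andP[] := a01 y; rewrite ?subr_ge0.
Qed.

Lemma trial_weightE (f g : V -> R) :
  \sum_(T : {set V}) (\prod_(y in T) f y) * (\prod_(y in ~: T) g y) =
  \prod_y (f y + g y).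
Proof.
rewrite bigA_distr; apply: eq_bigr => T _.
rewrite [RHS](bigID (mem T)) /=; congr (_ * _).
  by apply: eq_bigr => y ->.
rewrite (eq_bigl (fun y => y \notin T)); last by move=> y; rewrite inE.
by apply: eq_bigr => y /negPf ->.
Qed.

Lemma sum_trial_weight : \sum_T trial_weight T = 1.
Proof. by rewrite trial_weightE big1 // => y _; rewrite addrC subrK. Qed.

(** Replacing the failure factor at [x] by 0 removes the sets that miss [x] from the expanded
    product. *)
Lemma sum_trial_weight_in x : \sum_(T : {set V} | x \in T) trial_weight T = a x.
Proof.
transitivity (\prod_y (a y + (if y == x then 0 else 1 - a y))).
  rewrite -trial_weightE [RHS](bigID (fun T : {set V} => x \in T)) /=.
  rewrite [X in _ = _ + X]big1 ?addr0; last first.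
    move=> T xT; rewrite [X in _ * X](bigD1 x) ?inE //= eqxx.
    by rewrite mul0r mulr0.
  apply: eq_bigr => T xT; congr (_ * _); apply: eq_bigr => y; rewrite inE => yT.
  by case: eqP => // yx; rewrite yx xT in yT.
rewrite (bigD1 x) //= eqxx addr0 big1 ?mulr1 // => y /negPf ->.
by rewrite addrC subrK.
Qed.

Definition selection x : R :=
  \sum_(T : {set V} | x \in T) (#|T|%:R)^-1 * (\prod_(y in T) a y)
                                   * (\prod_(y in ~: T) (1 - a y)).

(** A set containing [x] has between 1 and [#|V|] elements, and the weights of such sets add up to
    [a x]. *)
Lemma selection_bounds x : #|V|%:R^-1 * a x <= selection x <= a x.
Proof.
have -> : selection x = \sum_(T : {set V} | x \in T) #|T|%:R^-1 * trial_weight T.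
  by apply: eq_bigr => T _; rewrite -mulrA.
rewrite -(sum_trial_weight_in x) mulr_sumr; apply/andP; split; apply: ler_sum => T xT.
  have T0 : (0 < #|T|)%N by apply/card_gt0P; exists x.
  rewrite ler_wpM2r ?trial_weight_ge0 // lef_pV2 ?posrE ?ltr0n ?ler_nat //.
    exact: max_card.
  by apply: leq_trans T0 (max_card _).
have T0 : (0 < #|T|)%N by apply/card_gt0P; exists x.
by rewrite ler_piMl ?trial_weight_ge0 // invf_le1 ?ltr0n // ler1n.
Qed.

(** After exchanging sums, a nonempty [T] is counted [#|T|] times with factor [1 / #|T|]; the
    rejection product is the weight of the empty set. *)
Lemma sum_selection : \sum_x selection x + \prod_y (1 - a y) = 1.
Proof.
rewrite /selection (exchange_big_dep predT) //=.
transitivity (\sum_T trial_weight T); last exact: sum_trial_weight.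
rewrite [RHS](bigD1 finset.set0) //= [LHS]addrC; congr (_ + _).
  rewrite /trial_weight finset.big_set0 mul1r.
  by apply: eq_bigl => y; rewrite !inE.
rewrite (bigD1 finset.set0) //= big1 ?add0r; last by move=> x; rewrite inE.
apply: eq_bigr => T T0; rewrite sumr_const -mulrA -mulrnAl.
by rewrite -[X in X * _]mulr_natr mulVf ?mul1r // pnatr_eq0 cards_eq0.
Qed.

End independent_trials.

Section digital_annealer.
Variables (R : realType) (V : finType) (H : config V -> R).

Definition flip_adj : rel (config V) := [rel s t | [exists x, t == flip s x]].

Lemma flipK x : involutive (fun s : config V => flip s x).
Proof. by move=> s; apply/ffunP => y; rewrite !ffunE; case: eqP => // _; rewrite negbK. Qed.

Lemma flip_inj (s : config V) : injective (flip s).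
Proof.
move=> x y /ffunP /(_ x); rewrite !ffunE eqxx; case: eqP => //.
by case: (s x).
Qed.

Lemma flip_neq (s : config V) x : flip s x != s.
Proof. by apply/eqP => /ffunP /(_ x); rewrite ffunE eqxx; case: (s x). Qed.

Lemma flip_adj_sym : symmetric flip_adj.
Proof.
suff adjW s t : flip_adj s t -> flip_adj t s by move=> s t; apply/idP/idP; apply: adjW.
by move=> /existsP[x /eqP ->]; apply/existsP; exists x; rewrite flipK.
Qed.

(** If no flip leaves [A], correcting one disagreeing site at a time reaches any [t] inside [A]. *)
Lemma flip_adj_connected : edge_connected flip_adj.
Proof.
move=> A /set0Pn[s sA] AT; apply: contrapT => noexit; move/negP: AT; apply.
apply/eqP/finset.setP => t; rewrite finset.in_setT.
have [m] := ubnP #|[set x | s x != t x]%SET|; elim: m s sA => // m IH s sA stm.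
have [->//|st] := eqVneq t s.
have [x sx] : exists x, s x != t x.
  apply/existsP; apply: contraNT st => /existsPn st; apply/eqP/ffunP => x.
  by apply/eqP; rewrite eq_sym -[_ == _]negbK.
have sxA : flip s x \in A.
  apply/negPn/negP => sxA; apply: noexit; exists s, (flip s x); split=> //.
  by apply/existsP; exists x.
apply: (IH (flip s x) sxA); rewrite ltnS in stm; apply: leq_trans stm.
apply: proper_card; apply/properP; split.
  apply/fintype.subsetP => y; rewrite !inE ffunE.
  by have [->|_] := eqVneq y x; rewrite ?sx.
exists x; rewrite !inE // ffunE eqxx.
by move: sx; case: (s x); case: (t x).
Qed.

Lemma accept01 beta s x : 0 <= beta -> 0 <= accept H beta s x <= 1.
Proof.
move=> b0; rewrite expR_ge0 expR_le1 oppr_le0 mulr_ge0 //.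
by rewrite le_max lexx orbT.
Qed.

Lemma accept_barrier beta s x :
  accept H beta s x = expR (- (beta * (barrier H s (flip s x) - H s))).
Proof.
rewrite /accept /energy_gap /barrier; congr (expR (- (beta * _))).
by rewrite maxC -[0](subrr (H s)) addr_maxl.
Qed.

Lemma DA_matrix_flip beta s x :
  DA_matrix H beta s (flip s x) = selection (accept H beta s) x.
Proof.
rewrite /DA_matrix; case: pickP => [y /eqP/flip_inj ->//|/(_ x)].
by rewrite eqxx.
Qed.

Lemma DA_matrix_nonadj beta s t : ~~ flip_adj s t ->
  DA_matrix H beta s t = if t == s then \prod_y (1 - accept H beta s y) else 0.
Proof.
move=> /existsPn st; rewrite /DA_matrix; case: pickP => // x.
by rewrite (negPf (st x)).
Qed.

Lemma DA_matrix_annealing beta : (0 < #|V|)%N -> 0 <= beta ->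
  annealing_kernel flip_adj H #|V|%:R^-1 beta (DA_matrix H beta).
Proof.
move=> V0 b0; have a01 s x : 0 <= accept H beta s x <= 1 by apply: accept01.
have adj_bounds s t : flip_adj s t ->
    #|V|%:R^-1 * expR (- (beta * (barrier H s t - H s))) <= DA_matrix H beta s t
      <= expR (- (beta * (barrier H s t - H s))).
  move=> /existsP[x /eqP ->]; rewrite -accept_barrier DA_matrix_flip.
  exact: selection_bounds.
split=> // [s t|s|s t ts st]; last by rewrite DA_matrix_nonadj // (negPf ts).
- have [/adj_bounds/andP[+ _]|st] := boolP (flip_adj s t).
    by apply: le_trans; rewrite mulr_ge0 ?expR_ge0.
  rewrite DA_matrix_nonadj //; case: ifP => // _.
  by apply: prodr_ge0 => y _; rewrite subr_ge0; have /andP[] := a01 s y.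
- transitivity (\sum_x selection (accept H beta s) x + \prod_y (1 - accept H beta s y)).
    2: exact: sum_selection.
  rewrite (bigID (flip_adj s)) /=; congr (_ + _).
    rewrite (eq_bigl (fun t => t \in flip s @: [set: V]%SET)); last first.
      move=> t; apply/existsP/imsetP => [[x /eqP ->]|[x _ ->]]; exists x => //.
    rewrite big_imset /=; last by move=> x y _ _; apply: flip_inj.
    by apply: eq_big => [x|x _]; rewrite ?finset.in_setT ?DA_matrix_flip.
  have ss : ~~ flip_adj s s.
    by apply/existsPn => x; rewrite eq_sym flip_neq.
  rewrite (bigD1 s) //= DA_matrix_nonadj // eqxx [X in _ + X]big1 ?addr0 // => t /andP[st ts].
  by rewrite DA_matrix_nonadj // (negPf ts).
Qed.

End digital_annealer.

(** * Marginal laws of the Markov chain *)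

Section markov_law.
Variables (d : measure_display) (T : measurableType d) (R : realType).
Variables (P : probability T R) (S : finType).

Definition law (X : nat -> T -> S) (k : nat) (s : S) : R :=
  fine (P [set t | X k t = s]).

Lemma probability_splits (Y : T -> S) (B : set T) :
  (forall A : set S, measurable (Y @^-1` A)) -> measurable B ->
  fine (P B) = \sum_s fine (P ([set t | Y t = s] `&` B)).
Proof.
move=> mY mB.
have mYB s : measurable ([set t | Y t = s] `&` B).
  by apply: measurableI => //; apply: (mY [set s]).
have {1}-> : B = \bigcup_(s in [set: S]) ([set t | Y t = s] `&` B).
  by apply/seteqP; split=> [t Bt|t [s _ []]//]; exists (Y t).
rewrite measure_fin_bigcup //; last 2 first.
- exact: finite_finset.
- apply/trivIsetP => s s' _ _ /eqP ss'; apply/seteqP; split=> // t [[/= Ys _] [/= Ys' _]].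
  by apply: ss'; rewrite -Ys -Ys'.
rewrite (fsbigE (enum S)) ?enum_uniq //; last first.
  by move=> s _; rewrite mem_enum.
rewrite (eq_bigl predT) => [|s]; last by rewrite in_setT.
rewrite -sum_fine ?big_enum // => s _.
exact: fin_num_measure.
Qed.

Variables (K : nat -> S -> S -> R) (X : nat -> T -> S).
Hypothesis XP : inhomogeneous_markov_chain P K X.

Let mX k (A : set S) : measurable (X k @^-1` A). Proof. by have [+ _] := XP; apply. Qed.

Lemma law_ge0 k s : 0 <= law X k s.
Proof. by rewrite fine_ge0. Qed.

Lemma law_sum1 k : \sum_s law X k s = 1.
Proof.
transitivity (fine (P setT)); last by rewrite probability_setT.
rewrite (probability_splits (mX k)) //.
by apply: eq_bigr => s _; rewrite setIT.
Qed.

Lemma fine_prob_gt0 (B : set T) : measurable B -> fine (P B) != 0 -> (0 < P B)%E.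
Proof.
move=> mB; apply: contra_neqT; rewrite -leNgt => PB0.
by have -> : P B = 0%E by apply/eqP; rewrite eq_le PB0 measure_ge0.
Qed.

(** The chain is constrained only along histories of positive probability, so one ending at [s] is
    needed. It is built backwards from time [k], each earlier value chosen by splitting an event of
    positive probability. *)
Lemma positive_history k s : law X k s != 0 ->
  exists2 u : nat -> S, u k = s &
    (0 < P [set t | forall j, (j < k.+1)%N -> X j t = u j])%E.
Proof.
move=> laws; pose hist (u : nat -> S) m :=
  [set t | forall j, (m <= j < k.+1)%N -> X j t = u j].
have mhist u m : measurable (hist u m).
  rewrite (_ : hist u m = \bigcap_(j in [set j | (m <= j < k.+1)%N]) (X j @^-1` [set u j])) //.
  by apply: bigcap_measurableType => j _; apply: mX.
suff main r : (r <= k)%N ->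
    exists2 u : nat -> S, u k = s & (0 < P (hist u (k - r)%N))%E.
  by have [u uk] := main k (leqnn k); rewrite subnn; exists u.
elim: r => [_|r IH rk].
  exists (fun=> s) => //; rewrite subn0.
  rewrite (_ : hist _ _ = [set t | X k t = s]).
    by apply: fine_prob_gt0 => //; apply: (mX k [set s]).
  apply/seteqP; split=> t /= Xt; first by apply: Xt; rewrite leqnn /=.
  by move=> j; rewrite ltnS -eqn_leq => /eqP <-.
have [u uk Pu] := IH (ltnW rk); set m := (k - r.+1)%N.
have mE : (k - r)%N = m.+1 by rewrite /m subnS prednK // subn_gt0.
rewrite mE in Pu.
have [v Pv] : exists v, 0 < fine (P ([set t | X m t = v] `&` hist u m.+1)).
  apply/not_existsP => noP.
  have : 0 < fine (P (hist u m.+1)).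
    by rewrite fine_gt0 // Pu ltey_eq fin_num_measure.
  rewrite (probability_splits (mX m)) // ltNge => /negP; apply.
  by apply: sumr_le0 => v _; rewrite leNgt; apply/negP/noP.
exists (fun j => if j == m then v else u j).
  by rewrite ifN // neq_ltn -(prednK (leq_ltn_trans (leq0n r) rk)); lia.
apply: lt_le_trans (fine_prob_gt0 _ (lt0r_neq0 Pv)) _.
  by apply: measurableI => //; apply: (mX m [set v]).
apply: le_measure; rewrite ?inE //.
  by apply: measurableI => //; apply: (mX m [set v]).
move=> t [/= Xv Xu] j /andP[mj jk]; case: eqVneq => [->//|jm].
by apply: Xu; rewrite jk andbT ltn_neqAle eq_sym jm.
Qed.

Lemma law_rec k t : law X k.+1 t = \sum_s law X k s * K k.+1 s t.
Proof.
rewrite /law (probability_splits (mX k)); last exact: (mX k.+1 [set t]).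
apply: eq_bigr => s _; set prev := [set _ | X k _ = s].
have mprev : measurable prev by apply: (mX k [set s]).
have mnow : measurable [set w | X k.+1 w = t] by apply: (mX k.+1 [set t]).
have [law0|lawn0] := eqVneq (law X k s) 0.
  rewrite /law in law0; rewrite law0 mul0r; apply/eqP; rewrite eq_le fine_ge0 // andbT.
  rewrite -law0 fine_le ?fin_num_measure //; first exact: measurableI.
  by apply: le_measure; rewrite ?inE //; apply: measurableI.
have [u uk Pu] := positive_history lawn0.
(* The target [t] is put at time [k.+1], which the conditioning history does not see. *)
have [_ /(_ k.+1 (fun j => if j == k.+1 then t else u j) isT)] := XP.
rewrite /= eqxx (ltn_eqF (ltnSn k)) uk; case.
  apply: lt_le_trans Pu _; apply: le_measure; rewrite ?inE.
  - rewrite (_ : mkset _ = \bigcap_(j in [set j | (j < k.+1)%N]) (X j @^-1` [set u j])) //.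
    by apply: bigcap_measurableType => j _; apply: mX.
  - rewrite (_ : mkset _ = \bigcap_(j in [set j | (j < k.+1)%N])
        (X j @^-1` [set if j == k.+1 then t else u j])) //.
    by apply: bigcap_measurableType => j _; apply: mX.
  - by move=> w Xw j jk; rewrite (ltn_eqF jk) Xw.
move=> _ <-; rewrite /cond_prob mulrC setIC divfK //.
Qed.

End markov_law.

(** * The criterion *)

Lemma nneseries1_pinftyP (R : realType) (u : nat -> R) : (forall k, 0 <= u k) ->
  (\sum_(1 <= k <oo) (u k)%:E = +oo)%E <->
  forall B, exists N, B <= \sum_(0 <= k < N) u k.+1.
Proof.
move=> u0; have partialE N :
    (\sum_(1 <= k < N.+1) (u k)%:E = (\sum_(0 <= k < N) u k.+1)%:E)%E.
  by rewrite sumEFin big_add1.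
have uE0 k : (1 <= k)%N -> xpredT k -> (0 <= (u k)%:E)%E by rewrite lee_fin.
split=> [sum_oo B|unbounded].
  apply: contrapT => /forallNP small.
  suff : (\sum_(1 <= k <oo) (u k)%:E <= B%:E)%E by rewrite sum_oo leye_eq.
  apply: lime_le; first exact: is_cvg_nneseries.
  apply: nearW => -[|N]; last by rewrite partialE lee_fin ltW // ltNge; apply/negP/small.
  rewrite big_geq // lee_fin; have := small 0%N.
  by rewrite big_geq // => /negP; rewrite -ltNge => /ltW.
apply/eqyP => B _; have [N NB] := unbounded B.
apply: le_trans (nneseries_lim_ge N.+1 _) => //.
by rewrite partialE lee_fin.
Qed.

(** The partial sums increase to a limit, so every block after a late index is at most the distance
    left to it. *)
Lemma bounded_partial_sums_tail (R : realType) (u : nat -> R) (B : R) :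
  (forall k, 0 <= u k) -> (forall N, \sum_(0 <= k < N) u k <= B) ->
  forall e, 0 < e -> exists K, forall K' m, (K <= K')%N ->
    \sum_(0 <= k < m) u (K' + k)%N <= e.
Proof.
move=> u0 uB e e0; pose s N := \sum_(0 <= k < N) u k.
have s_mono : nondecreasing_seq s.
  apply/nondecreasing_seqP => N; by rewrite /s big_nat_recr //= lerDl.
have s_cvg : cvgn s.
  by apply: nondecreasing_is_cvgn => //; exists B => _ [N _ <-]; apply: uB.
have /cvgrPdist_le /(_ _ e0) [K _ KP] := s_cvg.
exists K => K' m KK'.
have := KP K' KK'; rewrite /= ler_distlC => /andP[sK' _].
have := nondecreasing_cvgn_le s_mono s_cvg (K' + m)%N.
have -> : s (K' + m)%N = s K' + \sum_(0 <= k < m) u (K' + k)%N.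
  rewrite /s (big_cat_nat (leq0n K')) ?leq_addr //=; congr (_ + _).
  rewrite -{1}[K']add0n big_addn addKn.
  by apply: eq_bigr => k _; rewrite addnC.
lra.
Qed.

Section criterion.
Variables (R : realType) (V : finType) (H : config V -> R).

Lemma min_energy_le s : min_energy H <= H s.
Proof. by rewrite /min_energy; case: arg_minP => // t _; apply. Qed.

Lemma annealing_criterion :
  exists gamma : R,
    forall (beta : nat -> R), cooling_schedule beta ->
    forall (d : measure_display) (T : measurableType d)
      (P : probability T R) (X : nat -> T -> config V),
      inhomogeneous_markov_chain P (fun k => DA_matrix H (beta k)) X ->
      (P (X k @^-1` ground_states H) @[k --> \oo] --> 1%E) <->
      (\sum_(1 <= k <oo) (expR (- (beta k * gamma)))%:E = +oo)%E.
Proof.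
pose A := [set s | H s == min_energy H]%SET.
have inA s : (s \in A) = (H s == min_energy H) by rewrite finset.in_set.
have A0 : A != finset.set0.
  apply/set0Pn; rewrite /A /min_energy; case: arg_minP => // t _ _.
  by exists t; rewrite finset.in_set.
(* When every state is a ground state, [gamma = 0] makes both sides true. *)
have [AT|/forallPn[s0 s0A]] := boolP [forall s, s \in A].
  exists 0 => beta _ d T P X _; split=> _.
    apply/nneseries1_pinftyP => [k|B]; first exact: expR_ge0.
    exists (Num.truncn B).+1; under eq_bigr do rewrite mulr0 oppr0 expR0.
    rewrite sumr_const_nat subn0 ltW //; exact: truncnS_gt.
  under eq_fun => k.
    rewrite (_ : X k @^-1` _ = setT); last first.
      apply/seteqP; split=> // t _; apply/eqP; rewrite -inA; exact: (forallP AT).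
    rewrite probability_setT; over.
  exact: cvg_cst.
have V0 : (0 < #|V|)%N.
  rewrite lt0n; apply: contraNneq s0A => V0; have [a aA] := set0Pn _ A0.
  suff -> : s0 = a by [].
  by apply/ffunP => v; have := fintype0 v V0.
have conn := @flip_adj_connected V.
have [n [x order_n]] := exists_growth_order (barrier H) conn A0.
have [n0 npar _] := order_n.
(* [b] lies at the bottom of the deepest well outside the ground states; [s1] below has the second
   lowest energy and provides the gap [delta]. *)
have [b bA gammaP] := @Order.TotalTheory.arg_maxP _ _ _ s0 (fun s => s \notin A)
  (fun s => level x (n s) - H s) s0A.
have [s1 s1A s1min] := @Order.TotalTheory.arg_minP _ _ _ s0 (fun s => s \notin A) H s0A.
pose gamma := level x (n b) - H b; exists gamma => beta cool d T P X XP.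
have gamma0 : 0 <= gamma.
  have nb : (0 < n b)%N by rewrite lt0n n0.
  have [t [_ _ wt]] := npar _ nb; rewrite subr_ge0.
  apply: le_trans (_ : x (n b) <= _); first by rewrite -wt le_max lexx orbT.
  by apply: le_level; rewrite nb leqnn.
have c01 : 0 < (#|V|%:R^-1 : R) <= 1.
  by rewrite invr_gt0 ltr0n V0 invf_le1 ?ltr0n // ler1n.
have [beta_pos _ _] := cool.
have PK k : annealing_kernel (@flip_adj V) H #|V|%:R^-1 (beta k.+1) (DA_matrix H (beta k.+1)).
  by apply: DA_matrix_annealing => //; apply/ltW/beta_pos.
have muP : evolves (fun k => DA_matrix H (beta k)) 0 (law P X).
  split=> [k s|k|k t]; [exact: law_ge0 | exact: (law_sum1 XP) | exact: (law_rec XP)].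
have adjC := @flip_adj_sym V.
have GSE k : P (X k @^-1` ground_states H) = (\sum_(s in A) law P X k s)%:E.
  have [mX _] := XP; rewrite -[LHS]fineK ?fin_num_measure //; congr (_%:E).
  rewrite (probability_splits P (mX k)) // [RHS]big_mkcond; apply: eq_bigr => s _.
  case: ifP => sA; rewrite /law.
    congr (fine (P _)); apply/seteqP; split=> t; first by case.
    by move=> /= Xt; split=> //=; rewrite Xt; apply/eqP; rewrite -inA.
  rewrite (_ : _ `&` _ = set0) ?measure0 //; apply/seteqP; split=> // t [/= -> /eqP].
  by rewrite -inA sA.
have massE k : \sum_(s in A) law P X k s = 1 - \sum_(s | s \notin A) law P X k s.
  by have := law_sum1 XP k; rewrite (bigID (mem A)) /= => <-; rewrite addrK.
under eq_fun do rewrite GSE.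
have series_oo := nneseries1_pinftyP (fun k => expR_ge0 (- (beta k * gamma))).
split=> [lim1|/series_oo sum_div].
  apply/series_oo; apply: contrapT => /existsNP[B /forallNP bounded].
  have [|n' [x' order_n']] :=
      exists_growth_order (barrier H) conn (_ : [set b]%SET != finset.set0).
    by apply/set0Pn; exists b; rewrite finset.in_set1.
  have [a0 a0A] := set0Pn _ A0.
  (* With [a] the first ground state met when growing from [b], all ranks below [n' a] lie outside
     the ground states, so mass kept there contradicts the limit 1. *)
  have [a aA amin] := @arg_minnP _ a0 (fun s => s \in A) n' a0A.
  have [n'0 _ _] := order_n'.
  have a_gt0 : (0 < n' a)%N.
    by rewrite lt0n n'0 finset.in_set1; apply: contraNneq bA => <-.
  (* The minimax height is the same from either end, so the barrier out of [b] is at least the one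
     defining [gamma], and the exponentials inherit the small tails. *)
  have deep : gamma <= level x' (n' a) - H b.
    rewrite lerD2r; apply: (level_le_level adjC _ order_n order_n') => // s t.
    by rewrite /barrier maxC.
  have [|p [K [p0 pK]]] := mass_below_bounded c01 adjC cool PK a_gt0 muP order_n'.
    move=> e e0; have [||K KP] := @bounded_partial_sums_tail _
        (fun k => expR (- (beta k.+1 * gamma))) B _ _ e e0.
    - by move=> k; apply: expR_ge0.
    - by move=> N; rewrite ltW // ltNge; apply/negP/bounded.
    exists K => K' m KK'; apply: le_trans (KP K' m KK').
    apply: ler_sum => k _; rewrite ler_expR lerN2 ler_wpM2l //.
    exact/ltW/beta_pos.
  have /fine_cvgP[_] := lim1.
  move/cvgrPdist_lt => /(_ _ p0) [N _ NP].
  have := NP (maxn N K) (leq_maxl _ _); rewrite /= massE opprB addrCA subrr addr0.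
  rewrite ltNge => /negP; apply; apply: le_trans (ler_norm _).
  apply: le_trans (pK _ (leq_maxr _ _)) _.
  rewrite [leRHS](bigID (fun s => (n' s < n' a)%N)) /= -[leLHS]addr0 lerD //; last first.
    by apply: sumr_ge0 => s _; apply: law_ge0.
  rewrite le_eqVlt; apply/orP; left; apply/eqP; apply: eq_bigl => s.
  case: ltnP => sa; rewrite ?andbF ?andbT //.
  by apply/esym; apply: contraTN sa => sA; rewrite -leqNgt amin.
have delta0 : 0 < H s1 - min_energy H.
  by rewrite subr_gt0 lt_neqAle min_energy_le eq_sym -inA s1A.
have HA s : s \in A -> H s = min_energy H by rewrite inA => /eqP.
have HnA s : s \notin A -> min_energy H + (H s1 - min_energy H) <= H s.
  by move=> sA; rewrite addrCA subrr addr0 s1min.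
have above := mass_above_cvg0 c01 adjC cool PK order_n muP HA delta0 HnA
  gamma0 gammaP sum_div (ltn0Sn 0).
apply: cvg_EFin; first exact: nearW.
rewrite -[1]subr0; under eq_fun do rewrite /= massE.
apply: cvgB; first exact: cvg_cst.
suff -> : (fun k => \sum_(s | s \notin A) law P X k s) =
          (fun k => \sum_(s | (0 < n s)%N) law P X k s) by [].
by apply/funext => k; apply: eq_bigl => s; rewrite -n0 lt0n.
Qed.

End criterion.

Theorem theorem2p1 (R : realType) (V : finType) (e : rel V)
    (e_sym : symmetric e) (e_irrefl : irreflexive e)
    (J : V -> V -> R) (h : V -> R)
    (J_sym : forall x y, J x y = J y x)
    (J_supp : forall x y, ~~ e x y -> J x y = 0) :
  let H := hamiltonian J h in
  exists gamma : R,
    forall (beta : nat -> R), cooling_schedule beta ->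
    forall (d : measure_display) (T : measurableType d)
      (P : probability T R) (X : nat -> T -> config V),
      inhomogeneous_markov_chain P (fun k => DA_matrix H (beta k)) X ->
      (P (X k @^-1` ground_states H) @[k --> \oo] --> 1%E) <->
      (\sum_(1 <= k <oo) (expR (- (beta k * gamma)))%:E = +oo)%E.
Proof. exact: annealing_criterion. Qed.
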